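(* Let $\mathcal{L}=(\mathcal{B},\emptyset,\_)$ be a language with an arbitrary set $\mathcal{B}$ of base types and no constants. Assume $\Gamma\vdash_{\mathcal{L}} t : T$. Then there exist a type $M$ and terms $l,r$ with $\Gamma\vdash l : M$ and $(x:M)\vdash r : T$ such that (i) for every polarity $p\in\{+,-\}$, $M^p\subseteq \Gamma^p\cap T^p$; (ii) $\Gamma\vdash t\equiv r[l..] : T$.
   Context: Simply-typed $\lambda$-calculus with sums over a set $\mathcal{B}$ of base types. Types: $A,B::= b\ (b\in\mathcal{B})\mid \top\mid A\times B\mid A\to B\mid \bot\mid A+B$. Contexts $\Gamma$ are finite lists of typed variables $(x:A)$. Terms: variables, $\star$, pairs $(t,u)$, projections $\pi_1 t,\pi_2 t$, $\lambda x.t$, application $t\,u$, $\mathrm{raise}\,t$, $\mathrm{inl}\,t$, $\mathrm{inr}\,t$, and case analysis $\mathrm{case}\ s\ (x.b_l)\ (x.b_r)$. Typing $\Gamma\vdash t:A$: $x:A$ if $(x:A)\in\Gamma$; $\star:\top$; $(t,u):A\times B$ if $t:A$, $u:B$; $\pi_i p:A_i$ if $p:A_1\times A_2$; $\lambda x.t:A\to B$ if $\Gamma.(x:A)\vdash t:B$; $t\,u:B$ if $t:A\to B$, $u:A$; $\mathrm{raise}\,t:A$ (any $A$) if $t:\bot$; $\mathrm{inl}\,a:A+B$ if $a:A$; $\mathrm{inr}\,b:A+B$ if $b:B$; $\mathrm{case}\ s\ (x.b_l)\ (x.b_r):T$ if $s:A+B$, $\Gamma.(x:A)\vdash b_l:T$,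 $\Gamma.(x:B)\vdash b_r:T$. $r[l..]$ denotes the term obtained by substituting $l$ for the (last) variable $x$ of $r$. Conversion $\Gamma\vdash t\equiv u:A$ is the least typed congruent equivalence relation containing the $\beta$- and $\eta$-laws of every type former ($\top,\times,\to,\bot,+$), i.e. the equational theory of bicartesian closed categories. Polarised vocabulary $A^+,A^-\subseteq\mathcal{B}$ is defined by induction: $b^+=\{b\}$, $b^-=\emptyset$; $\top^p=\bot^p=\emptyset$; $(A+B)^p=(A\times B)^p=A^p\cup B^p$; $(A\to B)^p=A^{\bar p}\cup B^p$, where $\bar +=-$ and $\bar -=+$. For contexts, $(\Gamma.(x:A))^p=\Gamma^p\cup A^p$ and the empty context has empty vocabulary. *)

(* Defs.v *)
From Stdlib Require Import List Ensembles.
Import ListNotations.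

Set Implicit Arguments.
Unset Strict Implicit.
Unset Printing Implicit Defensive.

Inductive ty (B : Type) : Type :=
| Base (b : B)
| Top
| Prod (A1 A2 : ty B)
| Arr (A1 A2 : ty B)
| Bot
| Sum (A1 A2 : ty B).

Arguments Top {B}.
Arguments Bot {B}.

(* The head of the list is the most recently bound variable: the context
   extension Gamma.(x:A) is [A :: Gamma]. *)
Definition ctx (B : Type) : Type := list (ty B).

(* De Bruijn terms, without type annotations; [Lam] and each branch of [Case]
   bind one variable. *)
Inductive term : Type :=
| Var (n : nat)
| Star
| Pair (t u : term)
| Proj1 (t : term)
| Proj2 (t : term)
| Lam (t : term)
| App (t u : term)
| Raise (t : term)
| Inl (t : term)
| Inr (t : term)
| Case (s bl br : term).

Definition up_ren (xi : nat -> nat) (n : nat) : nat :=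
  match n with
  | 0 => 0
  | S m => S (xi m)
  end.

Fixpoint rename (xi : nat -> nat) (t : term) : term :=
  match t with
  | Var n => Var (xi n)
  | Star => Star
  | Pair t u => Pair (rename xi t) (rename xi u)
  | Proj1 t => Proj1 (rename xi t)
  | Proj2 t => Proj2 (rename xi t)
  | Lam t => Lam (rename (up_ren xi) t)
  | App t u => App (rename xi t) (rename xi u)
  | Raise t => Raise (rename xi t)
  | Inl t => Inl (rename xi t)
  | Inr t => Inr (rename xi t)
  | Case s bl br =>
      Case (rename xi s) (rename (up_ren xi) bl) (rename (up_ren xi) br)
  end.

Definition scons (u : term) (sigma : nat -> term) (n : nat) : term :=
  match n with
  | 0 => u
  | S m => sigma m
  end.

Definition up (sigma : nat -> term) : nat -> term :=
  scons (Var 0) (fun n => rename S (sigma n)).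

Fixpoint subst (sigma : nat -> term) (t : term) : term :=
  match t with
  | Var n => sigma n
  | Star => Star
  | Pair t u => Pair (subst sigma t) (subst sigma u)
  | Proj1 t => Proj1 (subst sigma t)
  | Proj2 t => Proj2 (subst sigma t)
  | Lam t => Lam (subst (up sigma) t)
  | App t u => App (subst sigma t) (subst sigma u)
  | Raise t => Raise (subst sigma t)
  | Inl t => Inl (subst sigma t)
  | Inr t => Inr (subst sigma t)
  | Case s bl br =>
      Case (subst sigma s) (subst (up sigma) bl) (subst (up sigma) br)
  end.

(* [subst1 u t] is t[u..]: u replaces the last variable of t. *)
Definition subst1 (u t : term) : term := subst (scons u Var) t.

Inductive typing (B : Type) : ctx B -> term -> ty B -> Prop :=
| ty_Var Gamma n A :
    nth_error Gamma n = Some A ->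
    typing Gamma (Var n) A
| ty_Star Gamma :
    typing Gamma Star Top
| ty_Pair Gamma t u A1 A2 :
    typing Gamma t A1 ->
    typing Gamma u A2 ->
    typing Gamma (Pair t u) (Prod A1 A2)
| ty_Proj1 Gamma t A1 A2 :
    typing Gamma t (Prod A1 A2) ->
    typing Gamma (Proj1 t) A1
| ty_Proj2 Gamma t A1 A2 :
    typing Gamma t (Prod A1 A2) ->
    typing Gamma (Proj2 t) A2
| ty_Lam Gamma t A1 A2 :
    typing (A1 :: Gamma) t A2 ->
    typing Gamma (Lam t) (Arr A1 A2)
| ty_App Gamma t u A1 A2 :
    typing Gamma t (Arr A1 A2) ->
    typing Gamma u A1 ->
    typing Gamma (App t u) A2
| ty_Raise Gamma t A :
    typing Gamma t Bot ->
    typing Gamma (Raise t) A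
| ty_Inl Gamma t A1 A2 :
    typing Gamma t A1 ->
    typing Gamma (Inl t) (Sum A1 A2)
| ty_Inr Gamma t A1 A2 :
    typing Gamma t A2 ->
    typing Gamma (Inr t) (Sum A1 A2)
| ty_Case Gamma s bl br A1 A2 T :
    typing Gamma s (Sum A1 A2) ->
    typing (A1 :: Gamma) bl T ->
    typing (A2 :: Gamma) br T ->
    typing Gamma (Case s bl br) T.

(* The eta-laws of the positive types are the full (extensional) ones, for an
   arbitrary term in a variable of type [Bot] or [Sum A1 A2]; they express the
   uniqueness of maps out of the initial object and out of coproducts. *)
Inductive conv (B : Type) : ctx B -> term -> term -> ty B -> Prop :=
| conv_refl Gamma t A :
    typing Gamma t A ->
    conv Gamma t t A
| conv_sym Gamma t u A :
    conv Gamma t u A ->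
    conv Gamma u t A
| conv_trans Gamma t u v A :
    conv Gamma t u A ->
    conv Gamma u v A ->
    conv Gamma t v A
| conv_Pair Gamma t t' u u' A1 A2 :
    conv Gamma t t' A1 ->
    conv Gamma u u' A2 ->
    conv Gamma (Pair t u) (Pair t' u') (Prod A1 A2)
| conv_Proj1 Gamma t t' A1 A2 :
    conv Gamma t t' (Prod A1 A2) ->
    conv Gamma (Proj1 t) (Proj1 t') A1
| conv_Proj2 Gamma t t' A1 A2 :
    conv Gamma t t' (Prod A1 A2) ->
    conv Gamma (Proj2 t) (Proj2 t') A2
| conv_Lam Gamma t t' A1 A2 :
    conv (A1 :: Gamma) t t' A2 ->
    conv Gamma (Lam t) (Lam t') (Arr A1 A2)
| conv_App Gamma t t' u u' A1 A2 :
    conv Gamma t t' (Arr A1 A2) ->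
    conv Gamma u u' A1 ->
    conv Gamma (App t u) (App t' u') A2
| conv_Raise Gamma t t' A :
    conv Gamma t t' Bot ->
    conv Gamma (Raise t) (Raise t') A
| conv_Inl Gamma t t' A1 A2 :
    conv Gamma t t' A1 ->
    conv Gamma (Inl t) (Inl t') (Sum A1 A2)
| conv_Inr Gamma t t' A1 A2 :
    conv Gamma t t' A2 ->
    conv Gamma (Inr t) (Inr t') (Sum A1 A2)
| conv_Case Gamma s s' bl bl' br br' A1 A2 T :
    conv Gamma s s' (Sum A1 A2) ->
    conv (A1 :: Gamma) bl bl' T ->
    conv (A2 :: Gamma) br br' T ->
    conv Gamma (Case s bl br) (Case s' bl' br') T
| conv_beta_Proj1 Gamma t u A1 A2 :
    typing Gamma t A1 ->
    typing Gamma u A2 ->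
    conv Gamma (Proj1 (Pair t u)) t A1
| conv_beta_Proj2 Gamma t u A1 A2 :
    typing Gamma t A1 ->
    typing Gamma u A2 ->
    conv Gamma (Proj2 (Pair t u)) u A2
| conv_beta_App Gamma t u A1 A2 :
    typing (A1 :: Gamma) t A2 ->
    typing Gamma u A1 ->
    conv Gamma (App (Lam t) u) (subst1 u t) A2
| conv_beta_Inl Gamma a bl br A1 A2 T :
    typing Gamma a A1 ->
    typing (A1 :: Gamma) bl T ->
    typing (A2 :: Gamma) br T ->
    conv Gamma (Case (Inl a) bl br) (subst1 a bl) T
| conv_beta_Inr Gamma a bl br A1 A2 T :
    typing Gamma a A2 ->
    typing (A1 :: Gamma) bl T ->
    typing (A2 :: Gamma) br T ->
    conv Gamma (Case (Inr a) bl br) (subst1 a br) T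
| conv_eta_Top Gamma t :
    typing Gamma t Top ->
    conv Gamma t Star Top
| conv_eta_Prod Gamma t A1 A2 :
    typing Gamma t (Prod A1 A2) ->
    conv Gamma t (Pair (Proj1 t) (Proj2 t)) (Prod A1 A2)
| conv_eta_Arr Gamma t A1 A2 :
    typing Gamma t (Arr A1 A2) ->
    conv Gamma t (Lam (App (rename S t) (Var 0))) (Arr A1 A2)
| conv_eta_Bot Gamma s t T :
    typing Gamma s Bot ->
    typing (Bot :: Gamma) t T ->
    conv Gamma (subst1 s t) (Raise s) T
| conv_eta_Sum Gamma s t A1 A2 T :
    typing Gamma s (Sum A1 A2) ->
    typing (Sum A1 A2 :: Gamma) t T ->
    conv Gamma (subst1 s t)
      (Case s (subst (scons (Inl (Var 0)) (fun n => Var (S n))) t)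
              (subst (scons (Inr (Var 0)) (fun n => Var (S n))) t)) T.

Inductive polarity : Type := Pos | Neg.

Definition flip_pol (p : polarity) : polarity :=
  match p with
  | Pos => Neg
  | Neg => Pos
  end.

Fixpoint voc (B : Type) (p : polarity) (A : ty B) : Ensemble B :=
  match A with
  | Base b =>
      match p with
      | Pos => Singleton B b
      | Neg => Empty_set B
      end
  | Top => Empty_set B
  | Bot => Empty_set B
  | Prod A1 A2 => Union B (voc p A1) (voc p A2)
  | Sum A1 A2 => Union B (voc p A1) (voc p A2)
  | Arr A1 A2 => Union B (voc (flip_pol p) A1) (voc p A2)
  end.

Fixpoint ctx_voc (B : Type) (p : polarity) (Gamma : ctx B) : Ensemble B :=
  match Gamma with
  | [] => Empty_set B
  | A :: Gamma' => Union B (ctx_voc p Gamma') (voc p A)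
  end.

(* Main.v *)
Require Import Defs.
From Stdlib Require Import List Ensembles.
Import ListNotations.

Set Implicit Arguments.
Unset Strict Implicit.

(** Every typed term is convertible to a normal form, in which case analysis and
    [raise] act on neutral terms only; this is a Kripke logical predicate argument,
    the commuting conversions being instances of the extensional eta-laws of [Bot]
    and [Sum].

    For a normal form over a context split into [Gamma1] and [Gamma2], Maehara's
    method produces [Gamma1 |- l : M] and [M, Gamma2 |- r : T] such that [M^p] is
    contained in [Gamma1^p] and in the union of [Gamma2^(-p)] and [T^p].  For a
    neutral term the roles of the two halves depend on which one contains the head
    variable, and a head variable in [Gamma1] is dealt with by an interpolant of
    function type.  The theorem is the case where [Gamma2] is empty. *)

(** * Substitution *)

(** Substitutions are functions; comparing them pointwise avoids an axiom of functional
    extensionality. *)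
Lemma subst_ext (sigma tau : nat -> term) (t : term) :
  (forall n, sigma n = tau n) -> subst sigma t = subst tau t.
Proof.
  revert sigma tau; induction t; intros sigma tau H; simpl; f_equal; auto;
    match goal with IH : forall s u, _ -> subst s ?t = _ |- subst _ ?t = _ =>
      apply IH; intros [|m]; simpl; auto; rewrite H; auto end.
Qed.

Lemma rename_as_subst (xi : nat -> nat) (t : term) :
  rename xi t = subst (fun n => Var (xi n)) t.
Proof.
  revert xi; induction t; intros xi; simpl; f_equal; auto;
    match goal with IH : forall xi, rename xi ?t = _ |- rename _ ?t = _ =>
      rewrite IH; apply subst_ext; intros [|m]; reflexivity end.
Qed.

Lemma subst_id (sigma : nat -> term) (t : term) :
  (forall n, sigma n = Var n) -> subst sigma t = t.
Proof.
  revert sigma; induction t; intros sigma H; simpl; f_equal; auto;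
    match goal with IH : forall s, _ -> subst s ?t = _ |- subst _ ?t = _ =>
      apply IH; intros [|m]; simpl; auto; rewrite H; auto end.
Qed.

Lemma subst_rename (sigma : nat -> term) (xi : nat -> nat) (t : term) :
  subst sigma (rename xi t) = subst (fun n => sigma (xi n)) t.
Proof.
  revert sigma xi; induction t; intros sigma xi; simpl; f_equal; auto;
    match goal with IH : forall s xi, subst s (rename xi ?t) = _ |- subst _ (rename _ ?t) = _ =>
      rewrite IH; apply subst_ext; intros [|m]; reflexivity end.
Qed.

Lemma rename_rename (xi zeta : nat -> nat) (t : term) :
  rename zeta (rename xi t) = rename (fun n => zeta (xi n)) t.
Proof. rewrite !rename_as_subst, <- rename_as_subst with (xi := xi), subst_rename; reflexivity. Qed.

Lemma rename_subst (sigma : nat -> term) (xi : nat -> nat) (t : term) :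
  rename xi (subst sigma t) = subst (fun n => rename xi (sigma n)) t.
Proof.
  revert sigma xi; induction t; intros sigma xi; simpl; f_equal; auto;
    match goal with IH : forall s xi, rename xi (subst s ?t) = _ |- rename _ (subst _ ?t) = _ =>
      rewrite IH; apply subst_ext; intros [|m]; simpl; auto; rewrite !rename_rename; reflexivity end.
Qed.

Lemma subst_subst (sigma tau : nat -> term) (t : term) :
  subst tau (subst sigma t) = subst (fun n => subst tau (sigma n)) t.
Proof.
  revert sigma tau; induction t; intros sigma tau; simpl; f_equal; auto;
    match goal with IH : forall s u, subst u (subst s ?t) = _ |- subst _ (subst _ ?t) = _ =>
      rewrite IH; apply subst_ext; intros [|m]; simpl; auto;
      rewrite subst_rename, rename_subst; reflexivity end.
Qed.

(** Renamings are turned into substitutions and composites are fused; the two sides are then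
    compared constructor by constructor and, under a substitution, variable by variable. *)
Ltac solve_subst :=
  unfold subst1, up; simpl;
  rewrite ?rename_as_subst, ?subst_subst; simpl;
  first
    [ reflexivity
    | match goal with
      | |- subst _ ?t = subst _ ?t =>
          apply subst_ext; let n := fresh "n" in intros [|n]; solve_subst
      | |- subst _ ?t = ?t =>
          apply subst_id; let n := fresh "n" in intros [|n]; solve_subst
      | |- ?t = subst _ ?t => symmetry; solve_subst
      | |- Pair _ _ = Pair _ _ => f_equal; solve_subst
      | |- Proj1 _ = Proj1 _ => f_equal; solve_subst
      | |- Proj2 _ = Proj2 _ => f_equal; solve_subst
      | |- Lam _ = Lam _ => f_equal; solve_subst
      | |- App _ _ = App _ _ => f_equal; solve_subst
      | |- Raise _ = Raise _ => f_equal; solve_subst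
      | |- Inl _ = Inl _ => f_equal; solve_subst
      | |- Inr _ = Inr _ => f_equal; solve_subst
      | |- Case _ _ _ = Case _ _ _ => f_equal; solve_subst
      end
    | match goal with
      | |- context [subst _ (?s ?n)] =>
          is_var s; is_var n; destruct (s n); solve_subst
      end ].

(** * Typing *)

Definition ren_ok (B : Type) (xi : nat -> nat) (Gamma Delta : ctx B) : Prop :=
  forall n A, nth_error Gamma n = Some A -> nth_error Delta (xi n) = Some A.

Definition subst_ok (B : Type) (sigma : nat -> term) (Gamma Delta : ctx B) : Prop :=
  forall n A, nth_error Gamma n = Some A -> typing Delta (sigma n) A.

Lemma ren_ok_up (B : Type) xi (Gamma Delta : ctx B) A :
  ren_ok xi Gamma Delta -> ren_ok (up_ren xi) (A :: Gamma) (A :: Delta).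
Proof. intros H [|n] C; simpl; auto. Qed.

Lemma ren_ok_S (B : Type) (Gamma : ctx B) A : ren_ok S Gamma (A :: Gamma).
Proof. intros n C; auto. Qed.

Lemma ren_ok_comp (B : Type) xi zeta (Gamma Delta Theta : ctx B) :
  ren_ok xi Gamma Delta -> ren_ok zeta Delta Theta ->
  ren_ok (fun n => zeta (xi n)) Gamma Theta.
Proof. intros H K n A e; auto. Qed.

Lemma ren_ok_shift (B : Type) xi (Gamma Delta : ctx B) A :
  ren_ok xi Gamma Delta -> ren_ok (fun n => S (xi n)) Gamma (A :: Delta).
Proof. intros H n C e; simpl; auto. Qed.

Create HintDb stlc.
#[local] Hint Constructors typing : stlc.
#[local] Hint Resolve ren_ok_up ren_ok_S : stlc.

Lemma typing_rename (B : Type) (Gamma : ctx B) t A :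
  typing Gamma t A ->
  forall Delta xi, ren_ok xi Gamma Delta -> typing Delta (rename xi t) A.
Proof. induction 1; intros Delta xi Hxi; simpl; econstructor; eauto with stlc. Qed.
#[local] Hint Resolve typing_rename : stlc.

Lemma subst_ok_up (B : Type) sigma (Gamma Delta : ctx B) A :
  subst_ok sigma Gamma Delta -> subst_ok (up sigma) (A :: Gamma) (A :: Delta).
Proof.
  intros H [|n] C e; simpl in *; eauto with stlc.
Qed.

Lemma subst_ok_scons (B : Type) sigma (Gamma Delta : ctx B) u A :
  typing Delta u A -> subst_ok sigma Gamma Delta ->
  subst_ok (scons u sigma) (A :: Gamma) Delta.
Proof. intros Hu H [|n] C e; simpl in *; auto; congruence. Qed.

Lemma subst_ok_ren (B : Type) xi (Gamma Delta : ctx B) :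
  ren_ok xi Gamma Delta -> subst_ok (fun n => Var (xi n)) Gamma Delta.
Proof. intros H n A e; eauto with stlc. Qed.

Lemma subst_ok_Var (B : Type) (Gamma : ctx B) : subst_ok Var Gamma Gamma.
Proof. intros n A e; eauto with stlc. Qed.
#[local] Hint Resolve subst_ok_up subst_ok_scons subst_ok_ren subst_ok_Var : stlc.

Lemma typing_subst (B : Type) (Gamma : ctx B) t A :
  typing Gamma t A ->
  forall Delta sigma, subst_ok sigma Gamma Delta -> typing Delta (subst sigma t) A.
Proof. induction 1; intros Delta sigma Hs; simpl; eauto with stlc; econstructor; eauto with stlc. Qed.
#[local] Hint Resolve typing_subst : stlc.

Lemma typing_subst1 (B : Type) (Gamma : ctx B) t u A C :
  typing (A :: Gamma) t C -> typing Gamma u A -> typing Gamma (subst1 u t) C.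
Proof. unfold subst1; eauto with stlc. Qed.
#[local] Hint Resolve typing_subst1 : stlc.

(** * Conversion *)

#[local] Hint Constructors conv : stlc.
#[local] Remove Hints conv_sym conv_trans : stlc.

Lemma conv_typing (B : Type) (Gamma : ctx B) t u A :
  conv Gamma t u A -> typing Gamma t A /\ typing Gamma u A.
Proof.
  induction 1;
    repeat match goal with H : _ /\ _ |- _ => destruct H end;
    split; eauto 6 with stlc.
  (* What remains is the expanded side of the eta-law of [Sum], whose branches replace a variable by
     an injection of the newly bound one. *)
  econstructor; [eassumption| |]; eapply typing_subst; try eassumption;
    apply subst_ok_scons; eauto with stlc;
    apply (subst_ok_ren (ren_ok_S _)).
Qed.

Lemma conv_typing_l (B : Type) (Gamma : ctx B) t u A :
  conv Gamma t u A -> typing Gamma t A.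
Proof. intros H; apply (conv_typing H). Qed.

Lemma conv_typing_r (B : Type) (Gamma : ctx B) t u A :
  conv Gamma t u A -> typing Gamma u A.
Proof. intros H; apply (conv_typing H). Qed.
#[local] Hint Resolve conv_typing_l conv_typing_r : stlc.

Lemma conv_subst (B : Type) (Gamma : ctx B) t u A :
  conv Gamma t u A ->
  forall Delta sigma, subst_ok sigma Gamma Delta ->
  conv Delta (subst sigma t) (subst sigma u) A.
Proof.
  induction 1; intros Delta sigma Hs; simpl;
    first [ solve [eauto using conv_sym, conv_trans with stlc]
          | solve [eapply conv_Case; eauto with stlc]
          | idtac ].
  - replace (subst sigma (subst1 u t)) with (subst1 (subst sigma u) (subst (up sigma) t))
      by solve_subst.
    eauto with stlc.
  - replace (subst sigma (subst1 a bl)) with (subst1 (subst sigma a) (subst (up sigma) bl))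
      by solve_subst.
    eapply conv_beta_Inl; eauto with stlc.
  - replace (subst sigma (subst1 a br)) with (subst1 (subst sigma a) (subst (up sigma) br))
      by solve_subst.
    eapply conv_beta_Inr; eauto with stlc.
  - replace (subst (up sigma) (rename S t)) with (rename S (subst sigma t))
      by solve_subst.
    eauto with stlc.
  - replace (subst sigma (subst1 s t)) with (subst1 (subst sigma s) (subst (up sigma) t))
      by solve_subst.
    eauto with stlc.
  - replace (subst sigma (subst1 s t)) with (subst1 (subst sigma s) (subst (up sigma) t))
      by solve_subst.
    (* Substituting before or after the eta-expansion gives syntactically equal terms, so
       reflexivity closes the gap once the branches are typed. *)
    eapply conv_trans; [eapply conv_eta_Sum; eauto with stlc|].
    match goal with |- conv _ ?a ?b _ => replace b with a by solve_subst end.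
    apply conv_refl; econstructor; eauto with stlc;
      eapply typing_subst; eauto with stlc;
      apply subst_ok_scons; eauto with stlc; apply (subst_ok_ren (ren_ok_S _)).
Qed.

Lemma conv_rename (B : Type) (Gamma Delta : ctx B) t u A xi :
  conv Gamma t u A -> ren_ok xi Gamma Delta ->
  conv Delta (rename xi t) (rename xi u) A.
Proof.
  intros H Hxi; rewrite !rename_as_subst; eapply conv_subst; eauto with stlc.
Qed.
#[local] Hint Resolve conv_rename : stlc.

Definition conv_substs (B : Type) (sigma tau : nat -> term) (Gamma Delta : ctx B) : Prop :=
  forall n A, nth_error Gamma n = Some A -> conv Delta (sigma n) (tau n) A.

Lemma conv_substs_up (B : Type) sigma tau (Gamma Delta : ctx B) A :
  conv_substs sigma tau Gamma Delta ->
  conv_substs (up sigma) (up tau) (A :: Gamma) (A :: Delta).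
Proof. intros H [|n] C e; simpl in *; eauto with stlc. Qed.
#[local] Hint Resolve conv_substs_up : stlc.

(** Complements [conv_subst]: here the term is fixed and the substitution varies. The congruence
    rules cover every term former, so induction on typing suffices. *)
Lemma conv_subst_cong (B : Type) (Gamma : ctx B) t A :
  typing Gamma t A ->
  forall Delta sigma tau, conv_substs sigma tau Gamma Delta ->
  conv Delta (subst sigma t) (subst tau t) A.
Proof. induction 1; intros Delta sigma tau Hs; simpl; eauto with stlc; eapply conv_Case; eauto with stlc. Qed.

Lemma conv_subst_scons (B : Type) (Gamma Delta : ctx B) t A C sigma u v :
  typing (A :: Gamma) t C -> subst_ok sigma Gamma Delta -> conv Delta u v A ->
  conv Delta (subst (scons u sigma) t) (subst (scons v sigma) t) C.
Proof.
  intros Ht Hs Huv; eapply conv_subst_cong; [eassumption|].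
  intros [|n] D e; simpl in *; [congruence|eauto with stlc].
Qed.

(* The eta-law of [Sum], at the term [e[case x t1 t2]] in the variable [x], yields
   the commutation of an arbitrary context [e] with a case analysis. *)
Lemma conv_comm_Case (B : Type) (Gamma : ctx B) n t1 t2 e A1 A2 C T :
  typing Gamma n (Sum A1 A2) ->
  typing (A1 :: Gamma) t1 C -> typing (A2 :: Gamma) t2 C ->
  typing (C :: Gamma) e T ->
  conv Gamma (subst1 (Case n t1 t2) e)
    (Case n (subst (scons t1 (fun k => Var (S k))) e)
            (subst (scons t2 (fun k => Var (S k))) e)) T.
Proof.
  intros Hn H1 H2 He.
  (* The given case analysis with a fresh variable as scrutinee, its branches weakened past that
     variable. *)
  set (q := Case (Var 0) (rename (up_ren S) t1) (rename (up_ren S) t2)).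
  assert (Hq : typing (Sum A1 A2 :: Gamma) q C)
    by (unfold q; econstructor; eauto with stlc; constructor; reflexivity).
  set (e' := subst (scons q (fun k => Var (S k))) e).
  assert (He' : typing (Sum A1 A2 :: Gamma) e' T).
  { eapply typing_subst; [eassumption|].
    apply subst_ok_scons; auto; apply (subst_ok_ren (ren_ok_S _)). }
  replace (subst1 (Case n t1 t2) e) with (subst1 n e')
    by (unfold e', q; solve_subst).
  eapply conv_trans; [eapply conv_eta_Sum; eassumption|].
  assert (Hv : forall A, typing (A :: Gamma) (Var 0) A) by (constructor; reflexivity).
  assert (HS : forall A, subst_ok (fun k => Var (S k)) Gamma (A :: Gamma))
    by (intros A; apply (subst_ok_ren (@ren_ok_S _ _ _))).
  apply conv_Case with A1 A2; [auto with stlc| |].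
  (* In each branch the scrutinee has become an injection of the bound variable, so the copy of [q]
     inside [e] beta-reduces. *)
  - replace (subst (scons (Inl (Var 0)) (fun k => Var (S k))) e') with
      (subst (scons (Case (Inl (Var 0)) (rename (up_ren S) t1) (rename (up_ren S) t2))
                (fun k => Var (S k))) e) by (unfold e', q; solve_subst).
    eapply conv_subst_scons; eauto.
    replace t1 with (subst1 (Var 0) (rename (up_ren S) t1)) at 2 by solve_subst.
    eapply conv_beta_Inl; eauto with stlc.
  - replace (subst (scons (Inr (Var 0)) (fun k => Var (S k))) e') with
      (subst (scons (Case (Inr (Var 0)) (rename (up_ren S) t1) (rename (up_ren S) t2))
                (fun k => Var (S k))) e) by (unfold e', q; solve_subst).
    eapply conv_subst_scons; eauto.
    replace t2 with (subst1 (Var 0) (rename (up_ren S) t2)) at 2 by solve_subst.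
    eapply conv_beta_Inr; eauto with stlc.
Qed.

(** This is the eta-law of [Bot] at the term obtained from [e] by putting [Raise] of a variable of
    type [Bot] in its hole. *)
Lemma conv_comm_Raise (B : Type) (Gamma : ctx B) n e C T :
  typing Gamma n Bot -> typing (C :: Gamma) e T ->
  conv Gamma (subst1 (Raise n) e) (Raise n) T.
Proof.
  intros Hn He.
  set (e' := subst (scons (Raise (Var 0)) (fun k => Var (S k))) e).
  replace (subst1 (Raise n) e) with (subst1 n e') by (unfold e'; solve_subst).
  apply conv_eta_Bot; auto.
  eapply typing_subst; [eassumption|].
  apply subst_ok_scons; [repeat constructor|apply (subst_ok_ren (@ren_ok_S _ _ _))].
Qed.

(** The instance of [conv_comm_Case] whose context [e] is itself a case analysis on the hole. *)
Lemma conv_Case_Case (B : Type) (Gamma : ctx B) n t1 t2 b1 b2 A1 A2 C1 C2 T :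
  typing Gamma n (Sum A1 A2) ->
  typing (A1 :: Gamma) t1 (Sum C1 C2) -> typing (A2 :: Gamma) t2 (Sum C1 C2) ->
  typing (C1 :: Gamma) b1 T -> typing (C2 :: Gamma) b2 T ->
  conv Gamma (Case (Case n t1 t2) b1 b2)
    (Case n (Case t1 (rename (up_ren S) b1) (rename (up_ren S) b2))
            (Case t2 (rename (up_ren S) b1) (rename (up_ren S) b2))) T.
Proof.
  intros Hn H1 H2 Hb1 Hb2.
  assert (He : typing (Sum C1 C2 :: Gamma)
                 (Case (Var 0) (rename (up_ren S) b1) (rename (up_ren S) b2)) T)
    by (econstructor; eauto with stlc; constructor; reflexivity).
  pose proof (conv_comm_Case Hn H1 H2 He) as H.
  match type of H with conv _ ?u ?v _ =>
    match goal with |- conv _ ?u' ?v' _ =>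
      replace u' with u by solve_subst; replace v' with v by solve_subst end end.
  exact H.
Qed.

Lemma conv_App_Case (B : Type) (Gamma : ctx B) n t1 t2 u A1 A2 C1 C2 :
  typing Gamma n (Sum A1 A2) ->
  typing (A1 :: Gamma) t1 (Arr C1 C2) -> typing (A2 :: Gamma) t2 (Arr C1 C2) ->
  typing Gamma u C1 ->
  conv Gamma (App (Case n t1 t2) u)
    (Case n (App t1 (rename S u)) (App t2 (rename S u))) C2.
Proof.
  intros Hn H1 H2 Hu.
  assert (He : typing (Arr C1 C2 :: Gamma) (App (Var 0) (rename S u)) C2)
    by (econstructor; [constructor; reflexivity|eauto with stlc]).
  pose proof (conv_comm_Case Hn H1 H2 He) as H.
  match type of H with conv _ ?u ?v _ =>
    match goal with |- conv _ ?u' ?v' _ =>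
      replace u' with u by solve_subst; replace v' with v by solve_subst end end.
  exact H.
Qed.

(** * Normalisation *)

Inductive ne (B : Type) : ctx B -> term -> ty B -> Prop :=
| ne_Var Gamma n A :
    nth_error Gamma n = Some A -> ne Gamma (Var n) A
| ne_Proj1 Gamma t A1 A2 :
    ne Gamma t (Prod A1 A2) -> ne Gamma (Proj1 t) A1
| ne_Proj2 Gamma t A1 A2 :
    ne Gamma t (Prod A1 A2) -> ne Gamma (Proj2 t) A2
| ne_App Gamma t u A1 A2 :
    ne Gamma t (Arr A1 A2) -> nf Gamma u A1 -> ne Gamma (App t u) A2
with nf (B : Type) : ctx B -> term -> ty B -> Prop :=
| nf_Star Gamma :
    nf Gamma Star Top
| nf_Pair Gamma t u A1 A2 :
    nf Gamma t A1 -> nf Gamma u A2 -> nf Gamma (Pair t u) (Prod A1 A2)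
| nf_Lam Gamma t A1 A2 :
    nf (A1 :: Gamma) t A2 -> nf Gamma (Lam t) (Arr A1 A2)
| nf_Inl Gamma t A1 A2 :
    nf Gamma t A1 -> nf Gamma (Inl t) (Sum A1 A2)
| nf_Inr Gamma t A1 A2 :
    nf Gamma t A2 -> nf Gamma (Inr t) (Sum A1 A2)
| nf_Raise Gamma t A :
    ne Gamma t Bot -> nf Gamma (Raise t) A
| nf_Case Gamma s bl br A1 A2 T :
    ne Gamma s (Sum A1 A2) -> nf (A1 :: Gamma) bl T -> nf (A2 :: Gamma) br T ->
    nf Gamma (Case s bl br) T
| nf_ne Gamma t A :
    ne Gamma t A -> nf Gamma t A.

Scheme ne_mut := Induction for ne Sort Prop
with nf_mut := Induction for nf Sort Prop.
Combined Scheme ne_nf_ind from ne_mut, nf_mut.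

#[local] Hint Constructors ne nf : stlc.

Lemma ne_nf_typing (B : Type) :
  (forall (Gamma : ctx B) t A, ne Gamma t A -> typing Gamma t A) /\
  (forall (Gamma : ctx B) t A, nf Gamma t A -> typing Gamma t A).
Proof. apply ne_nf_ind; intros; try assumption; econstructor; eassumption. Qed.

Lemma ne_typing (B : Type) (Gamma : ctx B) t A : ne Gamma t A -> typing Gamma t A.
Proof. apply ne_nf_typing. Qed.

Lemma nf_typing (B : Type) (Gamma : ctx B) t A : nf Gamma t A -> typing Gamma t A.
Proof. apply ne_nf_typing. Qed.
#[local] Hint Resolve ne_typing nf_typing : stlc.

Lemma ne_nf_rename (B : Type) :
  (forall (Gamma : ctx B) t A, ne Gamma t A ->
     forall Delta xi, ren_ok xi Gamma Delta -> ne Delta (rename xi t) A) /\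
  (forall (Gamma : ctx B) t A, nf Gamma t A ->
     forall Delta xi, ren_ok xi Gamma Delta -> nf Delta (rename xi t) A).
Proof.
  apply ne_nf_ind; intros; simpl;
    econstructor; eauto with stlc.
Qed.

Lemma ne_rename (B : Type) (Gamma Delta : ctx B) t A xi :
  ne Gamma t A -> ren_ok xi Gamma Delta -> ne Delta (rename xi t) A.
Proof. intros; eapply ne_nf_rename; eassumption. Qed.
#[local] Hint Resolve ne_rename : stlc.

(* At type [Sum] the predicate has to be stable under case analysis on neutral
   terms; elsewhere this stability is provable ([red_Case]). *)
Inductive cover (B : Type) (A1 A2 : ty B) (P1 P2 : ctx B -> term -> Prop) :
  ctx B -> term -> Prop :=
| cover_Inl Gamma t a :
    P1 Gamma a -> conv Gamma t (Inl a) (Sum A1 A2) -> cover A1 A2 P1 P2 Gamma t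
| cover_Inr Gamma t a :
    P2 Gamma a -> conv Gamma t (Inr a) (Sum A1 A2) -> cover A1 A2 P1 P2 Gamma t
| cover_Raise Gamma t n :
    ne Gamma n Bot -> conv Gamma t (Raise n) (Sum A1 A2) -> cover A1 A2 P1 P2 Gamma t
| cover_Case Gamma t n t1 t2 C1 C2 :
    ne Gamma n (Sum C1 C2) ->
    cover A1 A2 P1 P2 (C1 :: Gamma) t1 -> cover A1 A2 P1 P2 (C2 :: Gamma) t2 ->
    conv Gamma t (Case n t1 t2) (Sum A1 A2) -> cover A1 A2 P1 P2 Gamma t.

(** The [Arr] clause quantifies over renamings to allow fresh variables. At [Sum] the predicates of
    the two components are passed to [cover] as parameters, which keeps the definition structural in
    the type. *)
Fixpoint red (B : Type) (A : ty B) (Gamma : ctx B) (t : term) : Prop :=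
  match A with
  | Base _ | Top | Bot => exists u, nf Gamma u A /\ conv Gamma t u A
  | Prod A1 A2 =>
      typing Gamma t A /\ red A1 Gamma (Proj1 t) /\ red A2 Gamma (Proj2 t)
  | Arr A1 A2 =>
      typing Gamma t A /\
      forall Delta xi u, ren_ok xi Gamma Delta -> red A1 Delta u ->
        red A2 Delta (App (rename xi t) u)
  | Sum A1 A2 => cover A1 A2 (red A1) (red A2) Gamma t
  end.

Lemma red_typing (B : Type) (A : ty B) Gamma t : red A Gamma t -> typing Gamma t A.
Proof.
  destruct A; simpl; try (intros [u [_ Hu]]; eauto with stlc); try tauto.
  intros []; eauto with stlc.
Qed.
#[local] Hint Resolve red_typing : stlc.

(** Takes the place of closure under head expansion: it absorbs the beta-steps and commutations
    below. *)
Lemma red_conv (B : Type) (A : ty B) Gamma t u :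
  red A Gamma t -> conv Gamma t u A -> red A Gamma u.
Proof.
  revert Gamma t u; induction A as [b| |A1 IH1 A2 IH2|A1 IH1 A2 IH2| |A1 _ A2 _];
    simpl; intros Gamma t u Ht Htu.
  1, 2, 5: destruct Ht as [v [Hv Htv]]; eauto using conv_sym, conv_trans.
  - destruct Ht as [_ [H1 H2]]; split; [eauto with stlc|].
    split; [eapply IH1|eapply IH2]; eauto with stlc.
  - destruct Ht as [_ H]; split; [eauto with stlc|]; intros Delta xi v Hxi Hv.
    eapply IH2; [apply H; eauto|]; eauto with stlc.
  - destruct Ht; [eapply cover_Inl|eapply cover_Inr|eapply cover_Raise|eapply cover_Case];
      eauto using conv_sym, conv_trans.
Qed.

Lemma red_rename (B : Type) (A : ty B) Gamma Delta t xi :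
  red A Gamma t -> ren_ok xi Gamma Delta -> red A Delta (rename xi t).
Proof.
  revert Gamma Delta t xi; induction A as [b| |A1 IH1 A2 IH2|A1 IH1 A2 IH2| |A1 IH1 A2 IH2];
    simpl; intros Gamma Delta t xi Ht Hxi.
  1, 2, 5: destruct Ht as [v [Hv Htv]]; exists (rename xi v); split; eauto with stlc;
    eapply ne_nf_rename; eassumption.
  - destruct Ht as [H [H1 H2]]; split; [eauto with stlc|].
    split; [apply (IH1 _ _ _ _ H1 Hxi)|apply (IH2 _ _ _ _ H2 Hxi)].
  - destruct Ht as [H0 H]; split; [eauto with stlc|]; intros Theta zeta u Hz Hu.
    rewrite rename_rename; apply H; auto.
    eapply ren_ok_comp; eassumption.
  (* The induction on the cover is generalised over the renaming because [cover_Case] goes under a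
     binder. *)
  - revert Delta xi Hxi; induction Ht; intros Delta xi Hxi.
    + eapply cover_Inl; [eapply IH1; eassumption|].
      eapply conv_rename in Hxi; [|eassumption]; exact Hxi.
    + eapply cover_Inr; [eapply IH2; eassumption|].
      eapply conv_rename in Hxi; [|eassumption]; exact Hxi.
    + eapply cover_Raise; [eapply ne_rename; eassumption|].
      eapply conv_rename in Hxi; [|eassumption]; exact Hxi.
    + eapply cover_Case; [eapply ne_rename; eassumption| | |].
      * apply IHHt1; apply ren_ok_up; eassumption.
      * apply IHHt2; apply ren_ok_up; eassumption.
      * eapply conv_rename in Hxi; [|eassumption]; exact Hxi.
Qed.

(** At products and arrows, an eliminator applied to [Raise n] is convertible to [Raise n] at the
    smaller type. *)
Lemma red_Raise (B : Type) (A : ty B) Gamma n : ne Gamma n Bot -> red A Gamma (Raise n).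
Proof.
  revert Gamma n; induction A as [b| |A1 IH1 A2 IH2|A1 IH1 A2 IH2| |A1 _ A2 _];
    simpl; intros Gamma n Hn.
  1, 2, 5: exists (Raise n); eauto 6 with stlc.
  - split; [eauto with stlc|]; split.
    + eapply red_conv; [apply IH1; eassumption|].
      apply conv_sym, (conv_comm_Raise (C := Prod A1 A2) (e := Proj1 (Var 0)));
        eauto with stlc; econstructor; constructor; reflexivity.
    + eapply red_conv; [apply IH2; eassumption|].
      apply conv_sym, (conv_comm_Raise (C := Prod A1 A2) (e := Proj2 (Var 0)));
        eauto with stlc; econstructor; constructor; reflexivity.
  - split; [eauto with stlc|]; intros Delta xi u Hxi Hu; simpl.
    eapply red_conv; [apply IH2; eapply ne_rename; eassumption|].
    replace (App (Raise (rename xi n)) u)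
      with (subst1 (Raise (rename xi n)) (App (Var 0) (rename S u))) by solve_subst.
    apply conv_sym, conv_comm_Raise with (Arr A1 A2); eauto with stlc.
    econstructor; [constructor; reflexivity|eauto with stlc].
  - eapply cover_Raise; eauto with stlc.
Qed.

(** At products and arrows the eliminator is pushed into the branches, which reduces the claim to a
    smaller type; at sums it is a constructor of [cover]. *)
Lemma red_Case (B : Type) (A : ty B) Gamma n t1 t2 C1 C2 :
  ne Gamma n (Sum C1 C2) -> red A (C1 :: Gamma) t1 -> red A (C2 :: Gamma) t2 ->
  red A Gamma (Case n t1 t2).
Proof.
  revert Gamma n t1 t2; induction A as [b| |A1 IH1 A2 IH2|A1 IH1 A2 IH2| |A1 _ A2 _];
    intros Gamma n t1 t2 Hn H1 H2;
    assert (Ht : typing Gamma (Case n t1 t2) _)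
      by (econstructor; eauto with stlc).
  1, 2, 5: destruct H1 as [u1 [H1 E1]], H2 as [u2 [H2 E2]]; exists (Case n u1 u2);
    split; [|eapply conv_Case]; eauto with stlc.
  - destruct H1 as [T1 [H11 H12]], H2 as [T2 [H21 H22]].
    split; [assumption|]; split.
    + eapply red_conv; [eapply IH1; eassumption|].
      apply conv_sym.
      apply (@conv_comm_Case _ Gamma n t1 t2 (Proj1 (Var 0)) C1 C2 (Prod A1 A2));
        eauto with stlc; econstructor; constructor; reflexivity.
    + eapply red_conv; [eapply IH2; eassumption|].
      apply conv_sym.
      apply (@conv_comm_Case _ Gamma n t1 t2 (Proj2 (Var 0)) C1 C2 (Prod A1 A2));
        eauto with stlc; econstructor; constructor; reflexivity.
  - destruct H1 as [T1 H1], H2 as [T2 H2].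
    split; [assumption|]; intros Delta xi u Hxi Hu; simpl.
    assert (HuS : forall C, red A1 (C :: Delta) (rename S u))
      by (intros C; eapply red_rename; eauto with stlc).
    eapply red_conv.
    + eapply IH2; [eapply ne_rename; eassumption|apply (H1 _ (up_ren xi))|apply (H2 _ (up_ren xi))];
        auto with stlc.
    + apply conv_sym; eapply conv_App_Case; eauto with stlc.
  - eapply cover_Case; eauto with stlc.
Qed.

(** The two halves depend on each other: reflecting a neutral function reifies its argument, and
    reifying a function applies it to a reflected fresh variable. *)
Lemma reflect_reify (B : Type) (A : ty B) :
  (forall Gamma n, ne Gamma n A -> red A Gamma n) /\
  (forall Gamma t, red A Gamma t -> exists u, nf Gamma u A /\ conv Gamma t u A).
Proof.
  induction A as [b| |A1 [IH1 IH1'] A2 [IH2 IH2']|A1 [IH1 IH1'] A2 [IH2 IH2']| |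
                  A1 [IH1 IH1'] A2 [IH2 IH2']];
    simpl; split; auto; try (intros Gamma n Hn; exists n; split; eauto with stlc; fail).
  - intros Gamma n Hn; split; [|split]; eauto with stlc.
  - intros Gamma t [Ht [H1 H2]].
    destruct (IH1' _ _ H1) as [u1 [N1 E1]], (IH2' _ _ H2) as [u2 [N2 E2]].
    exists (Pair u1 u2); split; eauto using conv_trans with stlc.
  - intros Gamma n Hn; split; [eauto with stlc|]; intros Delta xi u Hxi Hu.
    destruct (IH1' _ _ Hu) as [v [Hv E]].
    apply red_conv with (App (rename xi n) v).
    + apply IH2; econstructor; eauto with stlc.
    + eapply conv_App; eauto using conv_sym with stlc.
  - intros Gamma t [Ht H].
    destruct (IH2' (A1 :: Gamma) (App (rename S t) (Var 0))) as [u [Hu E]].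
    { apply H; [apply ren_ok_S|]; apply IH1; constructor; reflexivity. }
    exists (Lam u); split; eauto using conv_trans with stlc.
  (* A neutral term of sum type is covered by its eta-expansion. *)
  - intros Gamma n Hn; eapply cover_Case; [eassumption| | |].
    + apply cover_Inl with (Var 0); [apply IH1; constructor; reflexivity|].
      repeat constructor.
    + apply cover_Inr with (Var 0); [apply IH2; constructor; reflexivity|].
      repeat constructor.
    + apply (@conv_eta_Sum _ Gamma n (Var 0) A1 A2); [eauto with stlc|constructor; reflexivity].
  - intros Gamma t Ht; induction Ht as [Gamma t a Ha E|Gamma t a Ha E|Gamma t n Hn E|
      Gamma t n t1 t2 C1 C2 Hn _ [u1 [N1 E1]] _ [u2 [N2 E2]] E].
    + destruct (IH1' _ _ Ha) as [u [Hu E']]; exists (Inl u); eauto using conv_trans with stlc.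
    + destruct (IH2' _ _ Ha) as [u [Hu E']]; exists (Inr u); eauto using conv_trans with stlc.
    + exists (Raise n); eauto with stlc.
    + exists (Case n u1 u2); split; [eauto with stlc|].
      eapply conv_trans; [eassumption|eapply conv_Case]; eauto with stlc.
Qed.

(** * Fundamental lemma of the logical predicate *)

Definition red_subst (B : Type) (sigma : nat -> term) (Gamma Delta : ctx B) : Prop :=
  forall n A, nth_error Gamma n = Some A -> red A Delta (sigma n).

Lemma red_subst_ok (B : Type) sigma (Gamma Delta : ctx B) :
  red_subst sigma Gamma Delta -> subst_ok sigma Gamma Delta.
Proof. intros H n A e; eauto with stlc. Qed.
#[local] Hint Resolve red_subst_ok : stlc.

Lemma red_subst_scons (B : Type) sigma (Gamma Delta : ctx B) u A :
  red A Delta u -> red_subst sigma Gamma Delta ->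
  red_subst (scons u sigma) (A :: Gamma) Delta.
Proof. intros Hu H [|n] C e; simpl in *; [congruence|auto]. Qed.

Lemma red_subst_rename (B : Type) sigma (Gamma Delta Theta : ctx B) xi :
  red_subst sigma Gamma Delta -> ren_ok xi Delta Theta ->
  red_subst (fun n => rename xi (sigma n)) Gamma Theta.
Proof. intros H Hxi n A e; eauto using red_rename. Qed.

(** The [Case] step of the fundamental lemma, by induction on the cover of the scrutinee: injections
    beta-reduce, while [Raise] and neutral case analyses commute outwards. The substitution is
    quantified after the cover since the context grows along it. *)
Lemma red_elim_Sum (B : Type) (A1 A2 T : ty B) Gamma bl br :
  typing (A1 :: Gamma) bl T -> typing (A2 :: Gamma) br T ->
  (forall Delta sigma, red_subst sigma (A1 :: Gamma) Delta -> red T Delta (subst sigma bl)) ->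
  (forall Delta sigma, red_subst sigma (A2 :: Gamma) Delta -> red T Delta (subst sigma br)) ->
  forall Delta s, cover A1 A2 (red A1) (red A2) Delta s ->
  forall sigma, red_subst sigma Gamma Delta ->
  red T Delta (Case s (subst (up sigma) bl) (subst (up sigma) br)).
Proof.
  intros Tl Tr Hl Hr Delta s Hs.
  induction Hs as [Delta s a Ha E|Delta s a Ha E|Delta s n Hn E|
                   Delta s n s1 s2 C1 C2 Hn H1 IH1 H2 IH2 E];
    intros sigma Hsig.
  - apply red_conv with (subst (scons a sigma) bl).
    + apply Hl; apply red_subst_scons; auto.
    + apply conv_sym.
      replace (subst (scons a sigma) bl) with (subst1 a (subst (up sigma) bl)) by solve_subst.
      eapply conv_trans; [eapply conv_Case; [exact E|..]; eauto with stlc|].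
      eapply conv_beta_Inl; eauto with stlc.
  - apply red_conv with (subst (scons a sigma) br).
    + apply Hr; apply red_subst_scons; auto.
    + apply conv_sym.
      replace (subst (scons a sigma) br) with (subst1 a (subst (up sigma) br)) by solve_subst.
      eapply conv_trans; [eapply conv_Case; [exact E|..]; eauto with stlc|].
      eapply conv_beta_Inr; eauto with stlc.
  - eapply red_conv; [apply red_Raise; eassumption|]; apply conv_sym.
    eapply conv_trans; [eapply conv_Case; [exact E|..]; eauto with stlc|].
    replace (Case (Raise n) (subst (up sigma) bl) (subst (up sigma) br)) with
      (subst1 (Raise n) (Case (Var 0) (rename (up_ren S) (subst (up sigma) bl))
                                      (rename (up_ren S) (subst (up sigma) br))))
      by solve_subst.
    apply conv_comm_Raise with (Sum A1 A2); [eauto with stlc|].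
    econstructor; [constructor; reflexivity|..];
      (eapply typing_rename; [eapply typing_subst|]; eauto with stlc).
  - assert (HS : forall C, red_subst (fun k => rename S (sigma k)) Gamma (C :: Delta))
      by (intros C; eapply red_subst_rename; eauto with stlc).
    eapply red_conv;
      [eapply red_Case; [eassumption|apply IH1; apply HS|apply IH2; apply HS]|].
    apply conv_sym.
    eapply conv_trans; [eapply conv_Case; [exact E|..]; eauto with stlc|].
    assert (Eb : forall b, subst (up (fun k => rename S (sigma k))) b =
                           rename (up_ren S) (subst (up sigma) b)) by (intros b; solve_subst).
    rewrite !Eb.
    eapply conv_Case_Case; eauto with stlc;
      eapply red_typing with (A := Sum A1 A2); eassumption.
Qed.

(** Reducibility at [Bot] only provides a normal form, so the induction is on that form: it is a
    [Raise], a [Case] with branches of type [Bot], or neutral. *)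
Lemma red_elim_Bot (B : Type) (T : ty B) Gamma s :
  red Bot Gamma s -> red T Gamma (Raise s).
Proof.
  intros [u [Hu E]]; apply red_conv with (Raise u); [clear s E|eauto using conv_sym with stlc].
  remember Bot as A eqn:EA.
  induction Hu as [| | | | |Gamma t A Hn|Gamma n bl br A1 A2 A Hn Hl IHl Hr IHr|Gamma n A Hn];
    subst; try discriminate.
  - eapply red_conv; [apply red_Raise; eassumption|]; apply conv_sym.
    apply (conv_comm_Raise (C := Bot) (e := Raise (Var 0))); eauto with stlc.
  - eapply red_conv; [eapply red_Case; [eassumption|apply IHl|apply IHr]; reflexivity|].
    apply conv_sym.
    apply (@conv_comm_Case _ Gamma n bl br (Raise (Var 0)) A1 A2 Bot); eauto with stlc.
  - apply red_Raise; assumption.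
Qed.

Lemma fundamental (B : Type) (Gamma : ctx B) t A :
  typing Gamma t A ->
  forall Delta sigma, red_subst sigma Gamma Delta -> red A Delta (subst sigma t).
Proof.
  induction 1; intros Delta sigma Hs.
  - simpl; auto.
  - exists Star; split; repeat constructor.
  - specialize (IHtyping1 _ _ Hs); specialize (IHtyping2 _ _ Hs).
    simpl; split; [eauto with stlc|].
    split; eapply red_conv; eauto using conv_sym with stlc.
  - apply (IHtyping _ _ Hs).
  - apply (IHtyping _ _ Hs).
  - assert (Ht : typing Delta (subst sigma (Lam t)) (Arr A1 A2)) by eauto with stlc.
    split; [exact Ht|]; intros Theta xi u Hxi Hu.
    apply red_conv with (subst (scons u (fun n => rename xi (sigma n))) t).
    + apply IHtyping; apply red_subst_scons; auto; eapply red_subst_rename; eauto.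
    + apply conv_sym; simpl.
      replace (subst (scons u (fun n => rename xi (sigma n))) t)
        with (subst1 u (rename (up_ren xi) (subst (up sigma) t))) by solve_subst.
      eapply conv_beta_App; [eapply typing_rename; [eapply typing_subst|]|]; eauto with stlc.
  - destruct (IHtyping1 _ _ Hs) as [Ht Hu].
    (* The Kripke clause is used at the identity renaming. *)
    apply red_conv with (App (rename (fun n => n) (subst sigma t)) (subst sigma u)).
    + apply Hu; [intros n A; auto|apply (IHtyping2 _ _ Hs)].
    + replace (rename (fun n => n) (subst sigma t)) with (subst sigma t) by solve_subst.
      eauto with stlc.
  - simpl; apply red_elim_Bot; auto.
  - simpl; eapply cover_Inl; eauto with stlc.
  - simpl; eapply cover_Inr; eauto with stlc.
  - simpl; eapply red_elim_Sum; eauto; apply (IHtyping1 _ _ Hs).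
Qed.

(** The fundamental lemma at the identity substitution, reducible by reflection, followed by
    reification. No reduction relation or termination argument is involved. *)
Theorem normalisation (B : Type) (Gamma : ctx B) t A :
  typing Gamma t A -> exists u, nf Gamma u A /\ conv Gamma t u A.
Proof.
  intros Ht; apply reflect_reify.
  replace t with (subst Var t) by (apply subst_id; reflexivity).
  eapply fundamental; [eassumption|].
  intros n C e; apply reflect_reify; constructor; assumption.
Qed.


(** * Interpolation of normal forms *)

(* [Gamma] is split, up to contraction, into [Gamma1] and [Gamma2]; using renamings
   rather than an interleaving of lists keeps exchange and binders cheap. *)
Definition split_ctx (B : Type) (Gamma1 Gamma2 Gamma : ctx B) (rho1 rho2 : nat -> nat) : Prop :=
  ren_ok rho1 Gamma1 Gamma /\ ren_ok rho2 Gamma2 Gamma /\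
  forall n A, nth_error Gamma n = Some A ->
    (exists m, nth_error Gamma1 m = Some A /\ rho1 m = n) \/
    (exists m, nth_error Gamma2 m = Some A /\ rho2 m = n).

Lemma split_ctx_sym (B : Type) (Gamma1 Gamma2 Gamma : ctx B) rho1 rho2 :
  split_ctx Gamma1 Gamma2 Gamma rho1 rho2 -> split_ctx Gamma2 Gamma1 Gamma rho2 rho1.
Proof.
  intros [H1 [H2 H]]; repeat split; auto.
  intros n A e; destruct (H n A e); auto.
Qed.

Lemma split_ctx_cons_r (B : Type) (Gamma1 Gamma2 Gamma : ctx B) rho1 rho2 A :
  split_ctx Gamma1 Gamma2 Gamma rho1 rho2 ->
  split_ctx Gamma1 (A :: Gamma2) (A :: Gamma) (fun n => S (rho1 n)) (up_ren rho2).
Proof.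
  intros [H1 [H2 H]]; repeat split; auto using ren_ok_shift, ren_ok_up.
  intros [|n] C e; [right; exists 0; auto|].
  destruct (H n C e) as [[m [em <-]]|[m [em <-]]]; [left; exists m|right; exists (S m)]; auto.
Qed.

Lemma split_ctx_cons_l (B : Type) (Gamma1 Gamma2 Gamma : ctx B) rho1 rho2 A :
  split_ctx Gamma1 Gamma2 Gamma rho1 rho2 ->
  split_ctx (A :: Gamma1) Gamma2 (A :: Gamma) (up_ren rho1) (fun n => S (rho2 n)).
Proof. intros H; apply split_ctx_sym, split_ctx_cons_r, split_ctx_sym, H. Qed.

(** Since [l] and [r] live over different halves of the context, both are carried to the common
    context before [l] replaces the last variable of [r]. *)
Definition plug (rho1 rho2 : nat -> nat) (l r : term) : term :=
  subst (scons (rename rho1 l) (fun n => Var (rho2 n))) r.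

(** [Gamma2] counts with flipped polarity because, seen from [M], the target of [r] is the type of
    functions from [Gamma2] to [T]. *)
Definition nf_interpolant (B : Type) (Gamma1 Gamma2 Gamma : ctx B) (rho1 rho2 : nat -> nat)
    (t : term) (T : ty B) : Prop :=
  exists M l r,
    typing Gamma1 l M /\ typing (M :: Gamma2) r T /\
    (forall p b, voc p M b ->
       ctx_voc p Gamma1 b /\ (ctx_voc (flip_pol p) Gamma2 b \/ voc p T b)) /\
    conv Gamma t (plug rho1 rho2 l r) T.

(* The head variable of the neutral term lies in [Gamma2], so the vocabulary of
   its type comes from [Gamma2] and need not be allowed in the interpolant. *)
Definition ne_interpolant (B : Type) (Gamma1 Gamma2 Gamma : ctx B) (rho1 rho2 : nat -> nat)
    (t : term) (T : ty B) : Prop :=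
  (forall p b, voc p T b -> ctx_voc p Gamma2 b) /\
  exists M l r,
    typing Gamma1 l M /\ typing (M :: Gamma2) r T /\
    (forall p b, voc p M b -> ctx_voc p Gamma1 b /\ ctx_voc (flip_pol p) Gamma2 b) /\
    conv Gamma t (plug rho1 rho2 l r) T.

(** * Polarised vocabularies *)

Lemma Union_iff (U : Type) (X Y : Ensemble U) x : Union U X Y x <-> X x \/ Y x.
Proof.
  split; [intros []|intros []]; auto; [apply Union_introl|apply Union_intror]; assumption.
Qed.

Lemma flip_pol_invol p : flip_pol (flip_pol p) = p.
Proof. destruct p; reflexivity. Qed.

Lemma Empty_set_iff (U : Type) x : Empty_set U x <-> False.
Proof. split; intros []. Qed.

Lemma voc_nth_error (B : Type) (Gamma : ctx B) n A p b :
  nth_error Gamma n = Some A -> voc p A b -> ctx_voc p Gamma b.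
Proof.
  revert n; induction Gamma as [|C Gamma IH]; intros [|n] e H; try discriminate;
    simpl in *; apply Union_iff; [injection e as ->|]; eauto.
Qed.

(** Each inclusion is instantiated at [p] and at [flip_pol p], as arrows exchange the two; the rest
    is propositional. *)
Ltac solve_voc :=
  repeat match goal with
    | H : forall p b, _ |- forall p b, _ =>
        let p := fresh "p" in let b := fresh "b" in
        intros p b; simpl;
        repeat match goal with K : forall p b, _ |- _ =>
          let K1 := fresh in let K2 := fresh in
          pose proof (K p b) as K1; pose proof (K (flip_pol p) b) as K2; clear K end
    end;
  simpl in *; rewrite ?Union_iff, ?flip_pol_invol, ?Empty_set_iff in *; tauto.

(** * Merging interpolants and passing under binders *)

(** Lets several subterms share one interpolant: their interpolants are paired, and each right-hand
    term reads its own component through a projection. *)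
Lemma plug_fst (B : Type) (Gamma1 Gamma2 Gamma : ctx B) rho1 rho2 l l' r M M' T :
  ren_ok rho1 Gamma1 Gamma -> ren_ok rho2 Gamma2 Gamma ->
  typing Gamma1 l M -> typing Gamma1 l' M' -> typing (M :: Gamma2) r T ->
  exists r', typing (Prod M M' :: Gamma2) r' T /\
    conv Gamma (plug rho1 rho2 l r) (plug rho1 rho2 (Pair l l') r') T.
Proof.
  intros Hr1 Hr2 Hl Hl' Hr; exists (subst (scons (Proj1 (Var 0)) (fun n => Var (S n))) r); split.
  - eapply typing_subst; [eassumption|].
    apply subst_ok_scons; [econstructor; constructor; reflexivity|].
    apply (subst_ok_ren (@ren_ok_S _ _ _)).
  - unfold plug.
    match goal with |- conv _ _ ?u _ =>
      replace u with (subst (scons (Proj1 (Pair (rename rho1 l) (rename rho1 l')))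
                               (fun n => Var (rho2 n))) r) by solve_subst end.
    eapply conv_subst_scons; [eassumption|eauto with stlc|].
    apply conv_sym; eauto with stlc.
Qed.

Lemma plug_snd (B : Type) (Gamma1 Gamma2 Gamma : ctx B) rho1 rho2 l l' r M M' T :
  ren_ok rho1 Gamma1 Gamma -> ren_ok rho2 Gamma2 Gamma ->
  typing Gamma1 l M -> typing Gamma1 l' M' -> typing (M' :: Gamma2) r T ->
  exists r', typing (Prod M M' :: Gamma2) r' T /\
    conv Gamma (plug rho1 rho2 l' r) (plug rho1 rho2 (Pair l l') r') T.
Proof.
  intros Hr1 Hr2 Hl Hl' Hr; exists (subst (scons (Proj2 (Var 0)) (fun n => Var (S n))) r); split.
  - eapply typing_subst; [eassumption|].
    apply subst_ok_scons; [econstructor; constructor; reflexivity|].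
    apply (subst_ok_ren (@ren_ok_S _ _ _)).
  - unfold plug.
    match goal with |- conv _ _ ?u _ =>
      replace u with (subst (scons (Proj2 (Pair (rename rho1 l) (rename rho1 l')))
                               (fun n => Var (rho2 n))) r) by solve_subst end.
    eapply conv_subst_scons; [eassumption|eauto with stlc|].
    apply conv_sym; eauto with stlc.
Qed.

(** The interpolant of a body puts [M] above the bound variable, whereas binding that variable in
    [r] requires it above [M]. *)
Definition swap (n : nat) : nat :=
  match n with 0 => 1 | 1 => 0 | _ => n end.

Lemma typing_swap (B : Type) (Gamma : ctx B) A C t T :
  typing (A :: C :: Gamma) t T -> typing (C :: A :: Gamma) (rename swap t) T.
Proof.
  intros H; eapply typing_rename; [eassumption|]; intros [|[|n]] D; auto.
Qed.

Lemma plug_swap rho1 rho2 l r :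
  subst (up (scons (rename rho1 l) (fun n => Var (rho2 n)))) (rename swap r) =
  plug (fun n => S (rho1 n)) (up_ren rho2) l r.
Proof.
  unfold plug; rewrite subst_rename; apply subst_ext; intros [|[|n]]; solve_subst.
Qed.

Lemma plug_Case_swap rho1 rho2 l s bl br :
  plug rho1 rho2 l (Case s (rename swap bl) (rename swap br)) =
  Case (plug rho1 rho2 l s)
    (plug (fun n => S (rho1 n)) (up_ren rho2) l bl)
    (plug (fun n => S (rho1 n)) (up_ren rho2) l br).
Proof. unfold plug at 1; simpl; rewrite !plug_swap; reflexivity. Qed.

(** * Interpolants for the individual term formers *)

(** A unary former acts on [r] alone, keeping [M] and [l]; the type may only gain vocabulary. *)
Lemma nf_interpolant_map (B : Type) (Gamma1 Gamma2 Gamma : ctx B) rho1 rho2 t A u T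
    (f : term -> term) :
  (forall Delta v, typing Delta v A -> typing Delta (f v) T) ->
  (forall sigma v, subst sigma (f v) = f (subst sigma v)) ->
  (forall v, conv Gamma t v A -> conv Gamma u (f v) T) ->
  (forall p b, voc p A b -> voc p T b) ->
  nf_interpolant Gamma1 Gamma2 Gamma rho1 rho2 t A ->
  nf_interpolant Gamma1 Gamma2 Gamma rho1 rho2 u T.
Proof.
  intros Hty Hs Hc Hv (M & l & r & Hl & Hr & HM & E).
  exists M, l, (f r); repeat split; auto.
  - apply (HM p b H).
  - specialize (HM p b H); specialize (Hv p b); tauto.
  - unfold plug; rewrite Hs; auto.
Qed.

Lemma ne_nf_interpolant_r (B : Type) (Gamma1 Gamma2 Gamma : ctx B) rho1 rho2 t T :
  ne_interpolant Gamma1 Gamma2 Gamma rho1 rho2 t T ->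
  nf_interpolant Gamma1 Gamma2 Gamma rho1 rho2 t T.
Proof.
  intros (HT & M & l & r & Hl & Hr & HM & E); exists M, l, r.
  repeat split; auto; destruct (HM p b H); auto.
Qed.

(** With the head variable in [Gamma1], [r] lives over [Gamma1] and is abstracted into a function,
    which the other half applies to [l]. The vocabulary of [T] comes from [Gamma1], and the domain
    position of [M] restores its polarities. *)
Lemma ne_nf_interpolant_l (B : Type) (Gamma1 Gamma2 Gamma : ctx B) rho1 rho2 t T :
  split_ctx Gamma1 Gamma2 Gamma rho1 rho2 ->
  ne_interpolant Gamma2 Gamma1 Gamma rho2 rho1 t T ->
  nf_interpolant Gamma1 Gamma2 Gamma rho1 rho2 t T.
Proof.
  intros (Hr1 & Hr2 & _) (HT & M & l & r & Hl & Hr & HM & E).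
  exists (Arr M T), (Lam r), (App (Var 0) (rename S l)); split; [|split; [|split]].
  - eauto with stlc.
  - econstructor; [constructor; reflexivity|eauto with stlc].
  - solve_voc.
  - eapply conv_trans; [exact E|]; apply conv_sym; unfold plug; simpl.
    match goal with |- conv _ (App _ ?u) ?v _ =>
      replace u with (rename rho2 l) by solve_subst;
      replace v with (subst1 (rename rho2 l) (rename (up_ren rho1) r)) by solve_subst end.
    eapply conv_beta_App; eauto with stlc.
Qed.

Lemma ne_interpolant_Var (B : Type) (Gamma1 Gamma2 Gamma : ctx B) rho1 rho2 m A :
  ren_ok rho2 Gamma2 Gamma -> nth_error Gamma2 m = Some A ->
  ne_interpolant Gamma1 Gamma2 Gamma rho1 rho2 (Var (rho2 m)) A.
Proof.
  intros Hr2 e; split; [intros p b; eapply voc_nth_error; eassumption|].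
  (* No information has to come from [Gamma1]; the successor skips the interpolant variable. *)
  exists Top, Star, (Var (S m)); split; [constructor|split; [constructor; exact e|split]].
  - intros p b [].
  - unfold plug; simpl; eauto with stlc.
Qed.

(** Here the type may only lose vocabulary, as under a projection, so that it stays within that of
    [Gamma2]. *)
Lemma ne_interpolant_map (B : Type) (Gamma1 Gamma2 Gamma : ctx B) rho1 rho2 t A u T
    (f : term -> term) :
  (forall Delta v, typing Delta v A -> typing Delta (f v) T) ->
  (forall sigma v, subst sigma (f v) = f (subst sigma v)) ->
  (forall v, conv Gamma t v A -> conv Gamma u (f v) T) ->
  (forall p b, voc p T b -> voc p A b) ->
  ne_interpolant Gamma1 Gamma2 Gamma rho1 rho2 t A ->
  ne_interpolant Gamma1 Gamma2 Gamma rho1 rho2 u T.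
Proof.
  intros Hty Hs Hc Hv (HT & M & l & r & Hl & Hr & HM & E); split; [auto|].
  exists M, l, (f r); repeat split; auto; try apply (HM p b H).
  unfold plug; rewrite Hs; auto.
Qed.

(** The interpolant of [u] may use the vocabulary of [A1]; as the domain of the type of a neutral
    term, [A1] has its flipped vocabulary in [Gamma2], which is what the bound requires. *)
Lemma ne_interpolant_App (B : Type) (Gamma1 Gamma2 Gamma : ctx B) rho1 rho2 t u A1 A2 :
  split_ctx Gamma1 Gamma2 Gamma rho1 rho2 ->
  ne_interpolant Gamma1 Gamma2 Gamma rho1 rho2 t (Arr A1 A2) ->
  nf_interpolant Gamma1 Gamma2 Gamma rho1 rho2 u A1 ->
  ne_interpolant Gamma1 Gamma2 Gamma rho1 rho2 (App t u) A2.
Proof.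
  intros (Hr1 & Hr2 & _) (HT & M & l & r & Hl & Hr & HM & E)
    (M' & l' & r' & Hl' & Hr' & HM' & E').
  split; [solve_voc|].
  destruct (plug_fst Hr1 Hr2 Hl Hl' Hr) as [q [Hq F]].
  destruct (plug_snd Hr1 Hr2 Hl Hl' Hr') as [q' [Hq' F']].
  exists (Prod M M'), (Pair l l'), (App q q'); split; [|split; [|split]];
    [eauto with stlc|eauto with stlc|solve_voc|].
  eapply conv_App; eapply conv_trans; eassumption.
Qed.

Lemma nf_interpolant_Pair (B : Type) (Gamma1 Gamma2 Gamma : ctx B) rho1 rho2 t u A1 A2 :
  split_ctx Gamma1 Gamma2 Gamma rho1 rho2 ->
  nf_interpolant Gamma1 Gamma2 Gamma rho1 rho2 t A1 ->
  nf_interpolant Gamma1 Gamma2 Gamma rho1 rho2 u A2 ->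
  nf_interpolant Gamma1 Gamma2 Gamma rho1 rho2 (Pair t u) (Prod A1 A2).
Proof.
  intros (Hr1 & Hr2 & _) (M & l & r & Hl & Hr & HM & E) (M' & l' & r' & Hl' & Hr' & HM' & E').
  destruct (plug_fst Hr1 Hr2 Hl Hl' Hr) as [q [Hq F]].
  destruct (plug_snd Hr1 Hr2 Hl Hl' Hr') as [q' [Hq' F']].
  exists (Prod M M'), (Pair l l'), (Pair q q'); split; [|split; [|split]];
    [eauto with stlc|eauto with stlc|solve_voc|].
  eapply conv_Pair; eapply conv_trans; eassumption.
Qed.

(** The bound variable joins [Gamma2], where [A1] counts with flipped polarity, just as in the
    domain of [Arr A1 A2]. *)
Lemma nf_interpolant_Lam (B : Type) (Gamma1 Gamma2 Gamma : ctx B) rho1 rho2 t A1 A2 :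
  nf_interpolant Gamma1 (A1 :: Gamma2) (A1 :: Gamma) (fun n => S (rho1 n)) (up_ren rho2) t A2 ->
  nf_interpolant Gamma1 Gamma2 Gamma rho1 rho2 (Lam t) (Arr A1 A2).
Proof.
  intros (M & l & r & Hl & Hr & HM & E).
  exists M, l, (Lam (rename swap r)); split; [|split; [|split]];
    [assumption|eauto using typing_swap with stlc|solve_voc|].
  unfold plug; simpl; rewrite plug_swap; eauto with stlc.
Qed.

(** The branch variables join [Gamma2], which already contains the vocabulary of [A1] and [A2]; the
    three interpolants are merged into a product. *)
Lemma nf_interpolant_Case_r (B : Type) (Gamma1 Gamma2 Gamma : ctx B) rho1 rho2 n bl br A1 A2 T :
  split_ctx Gamma1 Gamma2 Gamma rho1 rho2 ->
  ne_interpolant Gamma1 Gamma2 Gamma rho1 rho2 n (Sum A1 A2) ->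
  nf_interpolant Gamma1 (A1 :: Gamma2) (A1 :: Gamma) (fun n => S (rho1 n)) (up_ren rho2) bl T ->
  nf_interpolant Gamma1 (A2 :: Gamma2) (A2 :: Gamma) (fun n => S (rho1 n)) (up_ren rho2) br T ->
  nf_interpolant Gamma1 Gamma2 Gamma rho1 rho2 (Case n bl br) T.
Proof.
  intros (Hr1 & Hr2 & _) (HT & M & l & r & Hl & Hr & HM & E)
    (M1 & l1 & r1 & Hl1 & HR1 & HM1 & E1) (M2 & l2 & r2 & Hl2 & HR2 & HM2 & E2).
  assert (Hl12 : typing Gamma1 (Pair l1 l2) (Prod M1 M2)) by eauto with stlc.
  pose proof (@ren_ok_shift _ _ _ _ A1 Hr1) as K1; pose proof (@ren_ok_up _ _ _ _ A1 Hr2) as K2.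
  pose proof (@ren_ok_shift _ _ _ _ A2 Hr1) as K3; pose proof (@ren_ok_up _ _ _ _ A2 Hr2) as K4.
  destruct (plug_fst Hr1 Hr2 Hl Hl12 Hr) as [q [Hq F]].
  (* The branch interpolants sit two levels deep in the nested pair, hence two transports for
     each. *)
  destruct (plug_fst K1 K2 Hl1 Hl2 HR1) as [q1 [Hq1 F1]].
  destruct (plug_snd K1 K2 Hl Hl12 Hq1) as [q1' [Hq1' F1']].
  destruct (plug_snd K3 K4 Hl1 Hl2 HR2) as [q2 [Hq2 F2]].
  destruct (plug_snd K3 K4 Hl Hl12 Hq2) as [q2' [Hq2' F2']].
  exists (Prod M (Prod M1 M2)), (Pair l (Pair l1 l2)), (Case q (rename swap q1') (rename swap q2')).
  split; [|split; [|split]].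
  - eauto with stlc.
  - econstructor; eauto using typing_swap.
  - solve_voc.
  - rewrite plug_Case_swap; eapply conv_Case; eauto using conv_trans.
Qed.

(** [Gamma1] can analyse the scrutinee only once given the [M] supplied by [Gamma2], and then knows
    which branch interpolant to return: hence the type of functions from [M] to the sum of [M1] and
    [M2]. *)
Lemma nf_interpolant_Case_l (B : Type) (Gamma1 Gamma2 Gamma : ctx B) rho1 rho2 n bl br A1 A2 T :
  split_ctx Gamma1 Gamma2 Gamma rho1 rho2 ->
  ne_interpolant Gamma2 Gamma1 Gamma rho2 rho1 n (Sum A1 A2) ->
  nf_interpolant (A1 :: Gamma1) Gamma2 (A1 :: Gamma) (up_ren rho1) (fun n => S (rho2 n)) bl T ->
  nf_interpolant (A2 :: Gamma1) Gamma2 (A2 :: Gamma) (up_ren rho1) (fun n => S (rho2 n)) br T ->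
  nf_interpolant Gamma1 Gamma2 Gamma rho1 rho2 (Case n bl br) T.
Proof.
  intros (Hr1 & Hr2 & _) (HT & M & l & r & Hl & Hr & HM & E)
    (M1 & l1 & r1 & Hl1 & HR1 & HM1 & E1) (M2 & l2 & r2 & Hl2 & HR2 & HM2 & E2).
  set (d := Case r (Inl (rename (up_ren S) l1)) (Inr (rename (up_ren S) l2))).
  assert (Hd : typing (M :: Gamma1) d (Sum M1 M2))
    by (econstructor; eauto with stlc).
  exists (Arr M (Sum M1 M2)), (Lam d),
    (Case (App (Var 0) (rename S l)) (rename (up_ren S) r1) (rename (up_ren S) r2)).
  split; [|split; [|split]].
  - eauto with stlc.
  - econstructor; [econstructor; [constructor; reflexivity|]|..]; eauto with stlc.
  - solve_voc.
  - set (s1 := rename (up_ren rho2) r1); set (s2 := rename (up_ren rho2) r2).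
    set (k1 := rename (up_ren rho1) l1); set (k2 := rename (up_ren rho1) l2).
    assert (Hs1 : typing (M1 :: Gamma) s1 T) by (unfold s1; eauto with stlc).
    assert (Hs2 : typing (M2 :: Gamma) s2 T) by (unfold s2; eauto with stlc).
    assert (Hk1 : typing (A1 :: Gamma) k1 M1) by (unfold k1; eauto with stlc).
    assert (Hk2 : typing (A2 :: Gamma) k2 M2) by (unfold k2; eauto with stlc).
    match goal with |- conv _ _ ?u _ =>
      replace u with (Case (App (Lam (rename (up_ren rho1) d)) (rename rho2 l)) s1 s2)
        by (unfold plug, s1, s2; solve_subst) end.
    assert (Eb : conv Gamma (App (Lam (rename (up_ren rho1) d)) (rename rho2 l))
                   (Case n (Inl k1) (Inr k2)) (Sum M1 M2)).
    { eapply conv_trans; [eapply conv_beta_App; eauto with stlc|].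
      replace (subst1 (rename rho2 l) (rename (up_ren rho1) d))
        with (Case (plug rho2 rho1 l r) (Inl k1) (Inr k2))
        by (unfold plug, d, k1, k2; solve_subst).
      apply conv_sym; eapply conv_Case; eauto with stlc. }
    apply conv_sym.
    eapply conv_trans; [eapply conv_Case; [exact Eb|..]; apply conv_refl; assumption|].
    (* The outer analysis moves into the branches of the one on [n], where it meets an injection and
       beta-reduces. *)
    eapply conv_trans; [eapply conv_Case_Case; eauto with stlc|].
    eapply conv_Case; [eauto with stlc|..];
      (eapply conv_trans; [|apply conv_sym; eassumption]).
    + replace (plug (up_ren rho1) (fun n => S (rho2 n)) l1 r1)
        with (subst1 k1 (rename (up_ren S) s1)) by (unfold plug, k1, s1; solve_subst).
      eapply conv_beta_Inl; eauto with stlc.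
    + replace (plug (up_ren rho1) (fun n => S (rho2 n)) l2 r2)
        with (subst1 k2 (rename (up_ren S) s2)) by (unfold plug, k2, s2; solve_subst).
      eapply conv_beta_Inr; eauto with stlc.
Qed.

(** The disjunction records which half holds the head variable. Quantifying over all splittings lets
    the argument of an application be interpolated with the halves exchanged, and a branch with its
    variable on the side of the scrutinee. *)
Lemma ne_nf_interpolation (B : Type) :
  (forall (Gamma : ctx B) t A, ne Gamma t A ->
     forall Gamma1 Gamma2 rho1 rho2, split_ctx Gamma1 Gamma2 Gamma rho1 rho2 ->
     ne_interpolant Gamma1 Gamma2 Gamma rho1 rho2 t A \/
     ne_interpolant Gamma2 Gamma1 Gamma rho2 rho1 t A) /\
  (forall (Gamma : ctx B) t A, nf Gamma t A ->
     forall Gamma1 Gamma2 rho1 rho2, split_ctx Gamma1 Gamma2 Gamma rho1 rho2 ->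
     nf_interpolant Gamma1 Gamma2 Gamma rho1 rho2 t A).
Proof.
  apply ne_nf_ind.
  - intros Gamma n A e Gamma1 Gamma2 rho1 rho2 (Hr1 & Hr2 & H).
    destruct (H n A e) as [[m [em <-]]|[m [em <-]]];
      [right|left]; apply ne_interpolant_Var; assumption.
  - intros Gamma t A1 A2 _ IH Gamma1 Gamma2 rho1 rho2 Hsp.
    destruct (IH _ _ _ _ Hsp); [left|right];
      (eapply (ne_interpolant_map (f := Proj1)); [..|eassumption]; eauto with stlc; solve_voc).
  - intros Gamma t A1 A2 _ IH Gamma1 Gamma2 rho1 rho2 Hsp.
    destruct (IH _ _ _ _ Hsp); [left|right];
      (eapply (ne_interpolant_map (f := Proj2)); [..|eassumption]; eauto with stlc; solve_voc).
  - intros Gamma t u A1 A2 _ IHt _ IHu Gamma1 Gamma2 rho1 rho2 Hsp.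
    destruct (IHt _ _ _ _ Hsp); [left|right];
      eapply ne_interpolant_App; eauto using split_ctx_sym.
  - intros Gamma Gamma1 Gamma2 rho1 rho2 _.
    exists Top, Star, Star; split; [|split; [|split]]; eauto with stlc.
    intros p b [].
  - eauto using nf_interpolant_Pair.
  - eauto using nf_interpolant_Lam, split_ctx_cons_r.
  - intros Gamma t A1 A2 _ IH Gamma1 Gamma2 rho1 rho2 Hsp.
    eapply (nf_interpolant_map (f := Inl)); [..|eauto]; eauto with stlc; solve_voc.
  - intros Gamma t A1 A2 _ IH Gamma1 Gamma2 rho1 rho2 Hsp.
    eapply (nf_interpolant_map (f := Inr)); [..|eauto]; eauto with stlc; solve_voc.
  - intros Gamma t A _ IH Gamma1 Gamma2 rho1 rho2 Hsp.
    eapply (nf_interpolant_map (A := Bot) (f := Raise)); eauto with stlc; [intros p b []|].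
    destruct (IH _ _ _ _ Hsp); eauto using ne_nf_interpolant_r, ne_nf_interpolant_l.
  - intros Gamma s bl br A1 A2 T _ IHs _ IHl _ IHr Gamma1 Gamma2 rho1 rho2 Hsp.
    destruct (IHs _ _ _ _ Hsp).
    + eapply nf_interpolant_Case_r; eauto using split_ctx_cons_r.
    + eapply nf_interpolant_Case_l; eauto using split_ctx_cons_l.
  - intros Gamma t A _ IH Gamma1 Gamma2 rho1 rho2 Hsp.
    destruct (IH _ _ _ _ Hsp); eauto using ne_nf_interpolant_r, ne_nf_interpolant_l.
Qed.

Theorem mainTheorem1 (B : Type) (Gamma : ctx B) (t : term) (T : ty B)
    (Ht : typing Gamma t T) :
  exists (M : ty B) (l r : term),
    typing Gamma l M /\
    typing [M] r T /\
    (forall p : polarity,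
        Included B (voc p M) (Intersection B (ctx_voc p Gamma) (voc p T))) /\
    conv Gamma t (subst1 l r) T.
Proof.
  destruct (normalisation Ht) as [u [Hu E]].
  (* With identity renamings [plug] coincides with [subst1]. *)
  assert (Hsp : split_ctx Gamma [] Gamma (fun n => n) (fun n => n)).
  { split; [|split].
    - intros n A e; exact e.
    - intros [|n] A e; discriminate.
    - intros n A e; left; exists n; auto. }
  destruct (proj2 (ne_nf_interpolation B) _ _ _ Hu _ _ _ _ Hsp)
    as (M & l & r & Hl & Hr & HM & E').
  exists M, l, r; split; [exact Hl|split; [exact Hr|split]].
  (* The alternative of vocabulary from the empty [Gamma2] is absurd, so it lies in that of [T]. *)
  - intros p b Hb; destruct (HM p b Hb) as [H1 [[]|H2]]; split; assumption.
  - replace (subst1 l r) with (plug (fun n => n) (fun n => n) l r) by (unfold plug; solve_subst).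
    eapply conv_trans; eassumption.
Qed.
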